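(* Let $H$ be a separable complex Hilbert space, $A\in\mathcal{B}(H)^+$, $T\in\mathcal{B}(H)$, and let $m,n$ be nonnegative integers. Then the following hold. (1) If $T$ is $(A;(m,n))$-isosymmetric, then for every $s\in\mathbb{R}$, $$\sum_{k=0}^n(-1)^{n-k}\binom nk\big(e^{isT}\big)^{*k}\,\mathcal{I}^m_A(T)\,\big(e^{isT}\big)^k=0.$$ (2) If $T$ is skew $(A;(m,n))$-isosymmetric, then for every $s\in\mathbb{R}$, $$\sum_{k=0}^n(-1)^{n-k}\binom nk\big(e^{isT^*}\big)^{k}\,\mathcal{I}^m_A(T)\,\big(e^{isT}\big)^k=0.$$
   Context: $\mathcal{B}(H)$ is the algebra of bounded linear operators on $H$ and $\mathcal{B}(H)^+$ the set of positive (semi-definite) operators. For $A,T\in\mathcal{B}(H)$ and nonnegative integers $m,n$ put $$\mathcal{I}^m_A(T)=\sum_{k=0}^m(-1)^{m-k}\binom mk T^{*k}AT^k,\qquad \Omega_A^{m,n}(T)=\sum_{k=0}^n(-1)^{n-k}\binom nk T^{*k}\mathcal{I}^m_A(T)T^{n-k},\qquad \Lambda_A^{m,n}(T)=\sum_{k=0}^n\binom nk T^{*k}\mathcal{I}^m_A(T)T^{n-k}.$$ $T$ is $(A;(m,n))$-isosymmetric if $\Omega_A^{m,n}(T)=0$, and skew $(A;(m,n))$-isosymmetric if $\Lambda_A^{m,n}(T)=0$. *)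

(* Defs.v *)
From HB Require Import structures.
From mathcomp Require Import all_boot all_order all_algebra.
From mathcomp Require Import complex.
From mathcomp Require Import all_classical all_reals all_analysis.
From mathcomp Require Import ring lra.

Set Implicit Arguments.
Unset Strict Implicit.
Unset Printing Implicit Defensive.

Import Order.TTheory GRing.Theory Num.Theory.
Import numFieldNormedType.Exports.

Local Open Scope classical_set_scope.
Local Open Scope complex_scope.
Local Open Scope ring_scope.

HB.mixin Record CompleteNormedModule_isHilbert (R : realType) H
    of CompleteNormedModule R[i] H := {
  inner : {dot H for (@conjc R)} ;
  normr_inner : forall x : H, `|x| ^+ 2 = inner x x
}.

(* Complex Hilbert spaces; the inner product is linear in its first argument
   and conjugate-linear in the second one. *)
#[short(type="hilbertType")]
HB.structure Definition Hilbert (R : realType) :=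
  {H of CompleteNormedModule_isHilbert R H & CompleteNormedModule R[i] H}.

Definition separable (T : topologicalType) : Prop :=
  exists2 D : set T, countable D & dense D.

Section BoundedOperators.
Context {R : realType} (H : normedModType R[i]).

(* The scalar M is a complex number, but the order of R[i] only relates complex
   numbers with the same imaginary part, so that M is real unless H = 0. *)
Definition bounded_linear : {pred H -> H} := fun f =>
  `[< linear f /\ exists M : R[i], forall x, `|f x| <= M * `|x| >].

Lemma bounded_linearP (f : H -> H) :
  reflect (linear f /\ exists M : R[i], forall x, `|f x| <= M * `|x|)
          (f \in bounded_linear).
Proof. exact: asboolP. Qed.

Lemma bounded_linear_submod : submod_closed bounded_linear.
Proof.
split.
  apply/bounded_linearP; split; first by move=> a x y; rewrite scaler0 addr0.
  by exists 0 => x; rewrite normr0 mul0r.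
move=> a f g /bounded_linearP[lf [M Mf]] /bounded_linearP[lg [N Ng]].
apply/bounded_linearP; split.
  move=> b x y /=; rewrite !fctE lf lg !scalerDr !scalerA mulrC -!addrA.
  by congr (_ + _); rewrite addrCA.
exists (`|a| * M + N) => x; rewrite !fctE (le_trans (ler_normD _ _))// mulrDl lerD//.
by rewrite normrZ -mulrA ler_wpM2l.
Qed.

HB.instance Definition _ :=
  GRing.isSubmodClosed.Build R[i] (H -> H) bounded_linear bounded_linear_submod.

Record bop : Type := BOp { bop_fun :> H -> H ; _ : bop_fun \in bounded_linear }.

HB.instance Definition _ := [isSub for bop_fun].
HB.instance Definition _ := [Choice of bop by <:].
HB.instance Definition _ := [SubChoice_isSubLmodule of bop by <:].

Implicit Types A B C : bop.

Lemma bop_linear A : linear A.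
Proof. by case: A => f /= /bounded_linearP[]. Qed.

Lemma bop_bounded A : exists M : R[i], forall x, `|A x| <= M * `|x|.
Proof. by case: A => f /= /bounded_linearP[]. Qed.

Lemma bopP A B : A =1 B <-> A = B.
Proof. by split=> [AB|->//]; apply/val_inj/funext. Qed.

HB.instance Definition _ A :=
  GRing.isLinear.Build R[i] H H *:%R A (bop_linear A).

Lemma bop_id_subproof : (@id H) \in bounded_linear.
Proof.
by apply/bounded_linearP; split=> //; exists 1 => x; rewrite mul1r.
Qed.

Definition bop_id := BOp bop_id_subproof.

Lemma bop_comp_subproof A B : (A \o B) \in bounded_linear.
Proof.
apply/bounded_linearP; split=> [a x y|]; first by rewrite /= !linearP.
have [M MA] := bop_bounded A; have [N NB] := bop_bounded B.
exists (`|M| * N) => x /=; apply: (le_trans (MA _)).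
have [->|Bx0] := eqVneq (B x) 0.
  rewrite normr0 mulr0 -mulrA mulr_ge0//.
  exact: le_trans (normr_ge0 _) (NB x).
have M0 : 0 <= M.
  have := le_trans (normr_ge0 _) (MA (B x)).
  by rewrite pmulr_lge0// normr_gt0.
by rewrite ger0_norm// -mulrA ler_wpM2l.
Qed.

Definition bop_comp A B := BOp (bop_comp_subproof A B).

Lemma bop_compA : associative bop_comp.
Proof. by move=> A B C; apply/bopP. Qed.
Lemma bop_comp1l : left_id bop_id bop_comp.
Proof. by move=> A; apply/bopP. Qed.
Lemma bop_comp1r : right_id bop_id bop_comp.
Proof. by move=> A; apply/bopP. Qed.
Lemma bop_compDl : left_distributive bop_comp +%R.
Proof. by move=> A B C; apply/bopP. Qed.
Lemma bop_compDr : right_distributive bop_comp +%R.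
Proof. by move=> A B C; apply/bopP => x /=; rewrite [LHS]linearD. Qed.

(* Only a pzRingType, since 1 = 0 in the algebra of operators of the zero space. *)
HB.instance Definition _ := GRing.Zmodule_isPzRing.Build bop
  bop_compA bop_comp1l bop_comp1r bop_compDl bop_compDr.

(* A real number, seen in the scalar field R[i] because norms of normed modules
   over R[i] take their values in R[i]. *)
Definition opnorm A : R[i] :=
  (sup [set complex.Re `|A x| | x in [set x : H | `|x| <= 1]])%:C.

Let opset A := [set complex.Re `|A x| | x in [set x : H | `|x| <= 1]].

Let ReK (x : H) : (complex.Re `|x|)%:C = `|x|.
Proof. by rewrite RRe_real// ger0_real. Qed.

Let opset_sup A : has_sup (opset A).
Proof.
split; first by exists (complex.Re `|A 0|), 0 => //=; rewrite normr0.
have [M MA] := bop_bounded A; exists (complex.Re `|M|) => _ [x /= x1 <-].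
rewrite -lecR ReK -[leRHS]/(`|M|).
rewrite (le_trans (MA x))//; have [->|x0] := eqVneq x 0.
  by rewrite normr0 mulr0.
have M0 : 0 <= M.
  by have := le_trans (normr_ge0 _) (MA x); rewrite pmulr_lge0// normr_gt0.
by rewrite ger0_norm// ler_piMr.
Qed.

Lemma opnorm_ge A x : `|x| <= 1 -> `|A x| <= opnorm A.
Proof.
move=> x1; rewrite -ReK lecR; apply: ub_le_sup; first exact: (opset_sup A).2.
by exists x.
Qed.

Lemma opnorm_le A (M : R[i]) :
  (forall x, `|x| <= 1 -> `|A x| <= M) -> opnorm A <= M.
Proof.
move=> AM; have M0 : 0 <= M.
  by rewrite (le_trans _ (AM 0 _)) ?normr0.
rewrite -[leRHS]RRe_real ?ger0_real// lecR ge_sup//; first exact: (opset_sup A).1.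
by move=> _ [x /= x1 <-]; rewrite -lecR ReK RRe_real ?ger0_real ?AM.
Qed.

Lemma opnorm_ge0 A : 0 <= opnorm A.
Proof. by rewrite (le_trans _ (@opnorm_ge A 0 _)) ?normr0. Qed.

Lemma opnormP A x : `|A x| <= opnorm A * `|x|.
Proof.
have [->|x0] := eqVneq x 0; first by rewrite linear0 !normr0 mulr0.
rewrite -ler_pdivrMr ?normr_gt0// mulrC.
have -> : `|x|^-1 = `| `|x|^-1 | by rewrite normfV normr_id.
rewrite -normrZ -linearZ opnorm_ge//.
by rewrite normrZ normfV normr_id mulVf// normr_eq0.
Qed.

Lemma opnormD A B : opnorm (A + B) <= opnorm A + opnorm B.
Proof.
apply: opnorm_le => x x1.
by rewrite (le_trans (ler_normD _ _))// lerD// opnorm_ge.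
Qed.

Lemma opnormZ (a : R[i]) A : opnorm (a *: A) = `|a| * opnorm A.
Proof.
have le b B : opnorm (b *: B) <= `|b| * opnorm B.
  apply: opnorm_le => x x1.
  have -> : (b *: B) x = b *: B x by [].
  by rewrite normrZ ler_wpM2l// opnorm_ge.
apply/eqP; rewrite eq_le le/=; have [->|a0] := eqVneq a 0.
  by rewrite normr0 mul0r opnorm_ge0.
rewrite -ler_pdivlMl ?normr_gt0// -normfV -[A in leLHS]scale1r -(mulVf a0).
by rewrite -scalerA le.
Qed.

Lemma opnorm_eq0 A : opnorm A = 0 -> A = 0.
Proof.
move=> A0; apply/bopP => x; apply/eqP; rewrite -normr_eq0 eq_le normr_ge0 andbT.
by rewrite (le_trans (opnormP _ _))// A0 mul0r.
Qed.

HB.instance Definition _ :=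
  Lmodule_isNormed.Build R[i] bop opnormD opnormZ opnorm_eq0.

Lemma opnormM A B : opnorm (A * B) <= opnorm A * opnorm B.
Proof.
apply: opnorm_le => x x1; rewrite (le_trans (opnormP A (B x)))//.
by rewrite ler_wpM2l ?opnorm_ge0// opnorm_ge.
Qed.

Lemma opnormX A n : opnorm (A ^+ n) <= opnorm A ^+ n.
Proof.
elim: n => [|n ih]; first by rewrite !expr0; exact: opnorm_le.
by rewrite !exprS (le_trans (opnormM _ _))// ler_wpM2l ?opnorm_ge0.
Qed.

End BoundedOperators.

Section BoundedOperatorsComplete.
Context {R : realType} (H : completeNormedModType R[i]).

Lemma bop_complete (F : set_system (bop H)) :
  ProperFilter F -> cauchy F -> cvg F.
Proof.
move=> FF /cauchy_ballP Fc.
have Fd (e : R[i]) : 0 < e -> \forall A & B \near F, opnorm (A - B) < e.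
  by move=> /Fc; rewrite -ball_normE.
have Fex (e : R[i]) : 0 < e -> exists A, \forall B \near F, opnorm (A - B) < e.
  move=> e0; near F => A; exists A; near: A.
  by apply: nearP_dep; exact: Fd.
have Fx (x : H) : cvg ((fun A : bop H => A x) @ F).
  apply: cauchy_cvg; apply/cauchy_exP => e e0.
  have d0 : 0 < e / (`|x| + 1) by rewrite divr_gt0// ltr_wpDl.
  have [A FA] := Fex _ d0; exists (A x).
  rewrite /fmap/= -ball_normE; apply: filterS FA => B AB /=.
  have -> : A x - B x = (A - B) x by [].
  rewrite (le_lt_trans (opnormP _ _))//.
  rewrite (@le_lt_trans _ _ (e / (`|x| + 1) * `|x|))//.
    by rewrite ler_wpM2r// ltW.
  by rewrite mulrAC -mulrA gtr_pMr// ltr_pdivrMr ?ltr_wpDl// mul1r ltrDl.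
have [l Fl] : exists l : H -> H, forall x, (fun A : bop H => A x) @ F --> l x.
  by exists (fun x => lim ((fun A : bop H => A x) @ F)) => x; exact: Fx.
have Fle (x : H) (e : R[i]) : 0 < e -> F [set A : bop H | `|l x - A x| < e].
  by move=> e0; have /cvgrPdist_lt := Fl x; apply.
have ll : linear l.
  move=> a x y; apply/eqP; rewrite -subr_eq0 -normr_eq0 eq_le normr_ge0 andbT.
  apply/ler_addgt0Pr => e e0; rewrite add0r.
  have a0 : 0 < `|a| + 2 by rewrite ltr_wpDl.
  have d0 : 0 < e / (`|a| + 2) by rewrite divr_gt0.
  near F => A.
  have -> : l (a *: x + y) - (a *: l x + l y) =
     (l (a *: x + y) - A (a *: x + y)) - (a *: (l x - A x) + (l y - A y)).
    have -> : a *: (l x - A x) + (l y - A y) = a *: l x + l y - A (a *: x + y).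
      by rewrite linearP scalerBr opprD addrACA.
    by rewrite opprB addrA subrK.
  rewrite (le_trans (ler_normB _ _))//.
  have -> : e = e / (`|a| + 2) + (`|a| * (e / (`|a| + 2)) + e / (`|a| + 2)).
    rewrite -[LHS](@divfK _ (`|a| + 2)) ?gt_eqF// mulrDr mulr_natr mulr2n.
    by rewrite addrCA [_ * `|a|]mulrC.
  rewrite lerD//; first by rewrite ltW//; near: A; exact: Fle.
  rewrite (le_trans (ler_normD _ _))// lerD//.
    by rewrite normrZ ler_wpM2l// ltW//; near: A; exact: Fle.
  by rewrite ltW//; near: A; exact: Fle.
have lbd : exists M : R[i], forall x, `|l x| <= M * `|x|.
  have [A FA] := Fex 1 ltr01.
  exists (opnorm A + 1) => x; apply/ler_addgt0Pr => e e0.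
  near F => B.
  have -> : l x = (A x - (A - B) x) + (l x - B x).
    have -> : (A - B) x = A x - B x by [].
    by rewrite subKr addrC subrK.
  rewrite (le_trans (ler_normD _ _))// lerD//; last first.
    by rewrite ltW//; near: B; exact: Fle.
  rewrite (le_trans (ler_normB _ _))// mulrDl lerD ?opnormP//.
  rewrite (le_trans (opnormP _ _))// ler_wpM2r// ltW//.
  by near: B.
have lb : l \in @bounded_linear R H by apply/bounded_linearP.
apply/cvg_ex; exists (BOp lb); apply/cvgrPdist_le => e e0.
near=> A; apply: opnorm_le => x x1.
have FA : \forall B \near F, opnorm (A - B) < e.
  by near: A; apply: nearP_dep; exact: Fd.
have -> : (BOp lb - A) x = l x - A x by [].
apply/ler_addgt0Pr => d d0.
near F => B.
have -> : l x - A x = - (A - B) x + (l x - B x).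
  have -> : (A - B) x = A x - B x by [].
  by rewrite opprB [RHS]addrC addrA subrK.
rewrite (le_trans (ler_normD _ _))// lerD//.
  by rewrite normrN (le_trans (opnorm_ge _ _))// ltW//; near: B.
by rewrite ltW//; near: B; exact: Fle.
Unshelve. all: by end_near. Qed.

HB.instance Definition _ :=
  Uniform_isComplete.Build (bop H) bop_complete.

Lemma is_cvg_series_expB (A : bop H) :
  cvgn (series (fun k => k`!%:R^-1 *: A ^+ k)).
Proof.
apply/cauchy_cvgP/cauchy_seriesP => e e0.
pose r := complex.Re (opnorm A).
have rE : r%:C = opnorm A by rewrite /r RRe_real// ger0_real// opnorm_ge0.
have Re0 : 0 < complex.Re e by move: e0; rewrite ltcE => /andP[].
have /cauchy_cvgP/cauchy_seriesP/(_ _ Re0) := is_cvg_series_exp_coeff r.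
apply: filterS => -[m n] /= h; rewrite -(RRe_real (gtr0_real e0)).
rewrite -ltcR in h; apply: le_lt_trans h.
rewrite (le_trans (ler_norm_sum _ _ _))//.
apply: (@le_trans _ _ (\sum_(m <= k < n) exp_coeff r k)%:C); last first.
  by rewrite lecR ler_norm.
rewrite rmorph_sum/= ler_sum// => k _.
rewrite normrZ /exp_coeff/= rmorphM/= rmorphXn/= rE fmorphV rmorph_nat mulrC.
by rewrite normfV normr_nat ler_wpM2r ?invr_ge0 ?ler0n ?opnormX.
Qed.

(* The limit of the exponential series in operator norm. *)
Definition expB (A : bop H) : bop H :=
  limn (series (fun k => k`!%:R^-1 *: A ^+ k)).

End BoundedOperatorsComplete.

Section Adjoint.
Context {R : realType} {H : hilbertType R}.
Implicit Types (A T : bop H) (x y z : H).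

Let rip x y : R := complex.Re (inner x y).
Let n x : R := complex.Re `|x|.

Let nE x : (n x)%:C = `|x|.
Proof. by rewrite RRe_real// ger0_real. Qed.

Let n_ge0 x : 0 <= n x.
Proof. by rewrite -lecR nE; exact: normr_ge0. Qed.

Let ripxx x : rip x x = n x ^+ 2.
Proof. by rewrite /rip -normr_inner -nE -rmorphXn. Qed.

Let ReD (u v : R[i]) : complex.Re (u + v) = complex.Re u + complex.Re v.
Proof. by case: u => a b; case: v. Qed.

Let ripDl x y z : rip (x + y) z = rip x z + rip y z.
Proof. by rewrite /rip linearDl ReD. Qed.

Let ripDr x y z : rip z (x + y) = rip z x + rip z y.
Proof. by rewrite /rip linearDr ReD. Qed.

Let ripZl (a : R) x y : rip (a%:C *: x) y = a * rip x y.
Proof.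
rewrite /rip linearZl_LR/=.
by case: (inner x y) => b c; simpc.
Qed.

Let ripC x y : rip x y = rip y x.
Proof.
rewrite /rip hermC /= expr0 mul1r; case: (inner y x) => a b.
by [].
Qed.

Let ripZr (a : R) x y : rip x (a%:C *: y) = a * rip x y.
Proof. by rewrite ripC ripZl ripC. Qed.

Let ripN x y : rip (- x) y = - rip x y.
Proof.
have -> : - x = (-1)%:C *: x by rewrite rmorphN1 scaleN1r.
by rewrite ripZl mulN1r.
Qed.

Let ripNr x y : rip x (- y) = - rip x y.
Proof. by rewrite ripC ripN ripC. Qed.

Let ripii x y : rip ('i *: x) y = - complex.Im (inner x y).
Proof.
rewrite /rip linearZl_LR/=.
by case: (inner x y) => b c; simpc.
Qed.

Let rip_eq x y : (forall z, rip z x = rip z y) -> x = y.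
Proof.
move=> xy; apply/eqP; rewrite -subr_eq0 -normr_eq0 -nE -(rmorph0 (real_complex R)).
rewrite (inj_eq (@complexI _)) -sqrf_eq0 -ripxx ripDr ripNr xy subrr //.
Qed.

Let rip_cs x y : `|rip x y| <= n x * n y.
Proof.
rewrite -ler_sqr ?nnegrE ?mulr_ge0// -normrX ger0_norm ?sqr_ge0//.
rewrite exprMn -!ripxx.
have [->|y0] := eqVneq y 0.
  have r0 u : rip u 0 = 0 by rewrite -(scale0r u) -(rmorph0 (real_complex R)) ripZr mul0r.
  by rewrite !r0 expr0n mulr0.
have b0 : 0 < rip y y.
  by rewrite ripxx exprn_gt0// -ltcR nE normr_gt0.
have := ripxx ((rip y y)%:C *: x - (rip x y)%:C *: y).
have := sqr_ge0 (n ((rip y y)%:C *: x - (rip x y)%:C *: y)).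
move=> /[swap] <-.
rewrite !(ripDl, ripDr, ripN, ripNr, ripZl, ripZr) (ripC y x).
set a := rip x x; set b := rip y y in b0 *; set c := rip x y.
rewrite [leRHS](_ : _ = b * (a * b - c ^+ 2)); last by ring.
by rewrite pmulr_rge0// subr_ge0.
Qed.

Let sigT_ex (X : Type) (P : X -> Prop) : {f & P f} -> exists f, P f.
Proof. by case=> f; exists f. Qed.

(* Riesz representation, by minimizing x |-> |x|^2 - 2 p(x). *)
Let riesz (p : H -> R) (M : R) : 0 <= M ->
  (forall x y, p (x + y) = p x + p y) ->
  (forall (a : R) x, p (a%:C *: x) = a * p x) ->
  (forall x, `|p x| <= M * n x) ->
  exists z, forall x, p x = rip x z.
Proof.
move=> M0 pD pZ pM.
pose J x := rip x x - p x *+ 2.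
have Jlb : lbound (range J) (- M ^+ 2).
  move=> _ [x _ <-]; rewrite /J ripxx.
  have := pM x; rewrite ler_norml => /andP[_ h].
  have := sqr_ge0 (n x - M).
  rewrite -mulr_natr; set N := n x in h *; nra.
have Jinf : has_inf (range J).
  by split; [exists (J 0), 0|exists (- M ^+ 2)].
pose d := inf (range J).
have dJ x : d <= J x by apply: (ge_inf Jinf.2); exists x.
have Jd (e : R) : 0 < e -> exists x, J x < d + e.
  by move=> e0; have [_ [x _ <-] ?] := inf_adherent e0 Jinf; exists x.
have [u uP] : exists u : nat -> H, forall k, J (u k) < d + k.+1%:R^-1.
  apply: sigT_ex; apply: (@choice _ _ (fun k x => J x < d + k.+1%:R^-1)) => k.
  by apply: Jd; rewrite invr_gt0.
have Jpar x y : rip (x - y) (x - y) =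
    2 * J x + 2 * J y - 4 * J ((2^-1)%:C *: (x + y)).
  rewrite /J pZ !(ripDl, ripDr, ripN, ripNr, ripZl, ripZr) pD (ripC y x).
  by field.
have Jdist (e : R) x y : J x < d + e -> J y < d + e -> n (x - y) ^+ 2 <= 4 * e.
  move=> xe ye; rewrite -ripxx Jpar.
  by have := dJ ((2^-1)%:C *: (x + y)); lra.
have ucvg : cvg (u @ \oo).
  apply: cauchy_cvg; apply/cauchy_exP => e e0.
  have Re0 : 0 < complex.Re e by move: e0; rewrite ltcE => /andP[].
  have eE : (complex.Re e)%:C = e by rewrite RRe_real ?gtr0_real.
  have q0 : 0 < (complex.Re e) ^+ 2 / 8 by rewrite divr_gt0// exprn_gt0.
  have : \forall k \near \oo, k.+1%:R^-1 < (complex.Re e) ^+ 2 / 8.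
    by near=> k; near: k; exact: near_infty_natSinv_lt (PosNum q0).
  case=> N _ Nq; exists (u N); exists N => // k Nk.
  rewrite -ball_normE/= -nE -eE ltcR -ltr_sqr ?nnegrE// 1?ltW//.
  have lt m : (N <= m)%N -> J (u m) < d + (complex.Re e) ^+ 2 / 8.
    by move=> /Nq /= h; rewrite (lt_le_trans (uP m))// lerD2l ltW.
  have := Jdist _ _ _ (lt _ (leqnn N)) (lt _ Nk).
  have := exprn_gt0 2 Re0; lra.
have [z uz] : exists z, u @ \oo --> z by move/cvg_ex : ucvg.
exists z => h; apply/eqP; rewrite -subr_eq0; apply/eqP.
pose g := rip z h - p h.
have key (t : R) : 0 <= 2 * t * g + t ^+ 2 * rip h h.
  apply/ler_addgt0Pr => e e0.
  have c0 : 0 < 2 * `|t| * n h + 1 by rewrite ltr_wpDl// !mulr_ge0.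
  have q0 : 0 < e / 2 by rewrite divr_gt0.
  have r0 : 0 < e / 2 / (2 * `|t| * n h + 1) by rewrite divr_gt0.
  have r0c : 0 < (e / 2 / (2 * `|t| * n h + 1))%:C :> R[i] by rewrite ltcR.
  near \oo => k.
  have uk : n (z - u k) < e / 2 / (2 * `|t| * n h + 1).
    rewrite -ltcR nE; near: k.
    by move/cvgrPdist_lt : uz; apply.
  have uk2 : J (u k) < d + e / 2.
    rewrite (lt_le_trans (uP k))// lerD2l ltW//.
    by near: k; exact: near_infty_natSinv_lt (PosNum q0).
  have := dJ (u k + t%:C *: h).
  rewrite /J in uk2 *.
  rewrite !(ripDl, ripDr, ripZl, ripZr) pD pZ (ripC h (u k)) => dk.
  have : 2 * t * rip (z - u k) h >= - (e / 2).
    rewrite lerNl; apply: (le_trans (ler_norm _)).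
    rewrite normrN !normrM ger0_norm//.
    rewrite (@le_trans _ _ (2 * `|t| * (n (z - u k) * n h)))//.
      by rewrite ler_wpM2l// mulr_ge0.
    rewrite mulrCA mulrC.
    move: uk; rewrite ltr_pdivlMr// mulrDr mulr1 => /ltW.
    by apply: le_trans; rewrite [X in X <= _]mulrC lerDl.
  rewrite ripDl ripN /g.
  lra.
have g0 : g = 0.
  have [h0|h0] := eqVneq (rip h h) 0.
    have := key (- g); rewrite h0 mulr0 addr0 => k1.
    by apply/eqP; rewrite -sqrf_eq0 eq_le sqr_ge0 andbT; nra.
  have hp : 0 < rip h h by rewrite lt_neqAle eq_sym h0 ripxx sqr_ge0.
  have := key (- g / rip h h).
  rewrite [leRHS](_ : _ = - g ^+ 2 / rip h h); last by field.
  rewrite pmulr_lge0 ?invr_gt0// oppr_ge0 => k1.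
  by apply/eqP; rewrite -sqrf_eq0 eq_le sqr_ge0 andbT.
by rewrite ripC -opprB -/g g0 oppr0.
Unshelve. all: by end_near. Qed.

(* The default value 0 is never used, see adjP below. *)
Definition adj A : bop H :=
  xget 0 [set B : bop H | forall x y, inner (A x) y = inner x (B y)].

Lemma adjP A x y : inner (A x) y = inner x (adj A y).
Proof.
suff ex : [set B : bop H | forall x y, inner (A x) y = inner x (B y)] !=set0.
  by have := xgetPex 0 ex; exact.
clear x y.
have [b bP] : exists b : H -> H, forall y x, rip (A x) y = rip x (b y).
  apply: sigT_ex; apply: (@choice _ _ (fun y z => forall x, rip (A x) y = rip x z)) => y.
  apply: (@riesz (fun x => rip (A x) y) (complex.Re (opnorm A) * n y)).
  - by rewrite mulr_ge0// -lecR RRe_real ?ger0_real// opnorm_ge0.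
  - by move=> x1 x2; rewrite linearD ripDl.
  - by move=> a x; rewrite linearZ ripZl.
  - move=> x; rewrite (le_trans (rip_cs _ _))// mulrAC ler_wpM2r//.
    rewrite -lecR nE rmorphM/= nE.
    exact: opnormP.
have bI x y : inner (A x) y = inner x (b y).
  apply/eqP; rewrite eq_complex; apply/andP; split; apply/eqP.
    exact: bP.
  by apply: oppr_inj; rewrite -!ripii -linearZ bP.
have bl : linear b.
  move=> a x y; apply: rip_eq => z; rewrite /rip -bI.
  by rewrite !linearDr/= !linearZr_LR/= !bI.
have bb : exists M : R[i], forall x, `|b x| <= M * `|x|.
  exists (opnorm A) => x.
  have [->|bx0] := eqVneq (b x) 0.
    by rewrite normr0 mulr_ge0// opnorm_ge0.
  rewrite -(@ler_pM2r _ `|b x|) ?normr_gt0//.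
  rewrite -expr2 normr_inner -bI.
  have -> : inner (A (b x)) x = (rip (A (b x)) x)%:C.
    by rewrite /rip bI -normr_inner RRe_real// ger0_real// exprn_ge0.
  have := rip_cs (A (b x)) x; rewrite -lecR => h.
  apply: le_trans (le_trans _ h) _; first by rewrite lecR ler_norm.
  by rewrite rmorphM/= !nE mulrAC ler_wpM2r// opnormP.
have bB : b \in @bounded_linear R H by apply/bounded_linearP.
by exists (BOp bB).
Qed.

(* In the order of R[i], 0 <= c says that c is real and nonnegative; over the
   complex numbers this makes A self-adjoint. *)
Definition positive A : Prop := forall x, 0 <= inner (A x) x.

Definition Iop m A T : bop H :=
  \sum_(k < m.+1)
    ((-1) ^+ (m - k) * 'C(m, k)%:R) *: (adj T ^+ k * A * T ^+ k).

Definition Omega m n A T : bop H :=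
  \sum_(k < n.+1)
    ((-1) ^+ (n - k) * 'C(n, k)%:R) *: (adj T ^+ k * Iop m A T * T ^+ (n - k)).

Definition Lambda m n A T : bop H :=
  \sum_(k < n.+1)
    'C(n, k)%:R *: (adj T ^+ k * Iop m A T * T ^+ (n - k)).

Definition isosymmetric m n A T : Prop := Omega m n A T = 0.

Definition skew_isosymmetric m n A T : Prop := Lambda m n A T = 0.

End Adjoint.

(* Main.v *)
Require Import Defs.
From mathcomp Require Import all_boot all_order all_algebra.
From mathcomp Require Import complex.
From mathcomp Require Import all_classical all_reals all_analysis.
From mathcomp Require Import ring.

Set Implicit Arguments.
Unset Strict Implicit.
Unset Printing Implicit Defensive.

Import Order.TTheory GRing.Theory Num.Theory.
Import numFieldNormedType.Exports.

Local Open Scope complex_scope.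
Local Open Scope ring_scope.

(** Let [L_P X = P * X] and [R_Q X = X * Q] be the multiplications on the
    Banach algebra of bounded operators.  They commute, and by the binomial
    formula
      [(L_P + R_Q)^n X = sum_k C(n,k) P^k X Q^(n-k)].
    Write [D = L_P + R_Q], and let [X] be the operator [I^m_A(T)], [T'] the
    adjoint of [T], and [Q = i s T].  If [P = - i s T'], then [D^n X] is
    [(- i s)^n] times [Omega]; if [P = i s T'], it is [(i s)^n] times [Lambda].
    So the hypotheses give [D^n X = 0].  Both conclusions say that
    [(L_(exp P) R_(exp Q) - 1)^n X = 0], since
    [adj (exp (i s T)) = exp (- i s T')] ([adj_expB]).  Now
      [L_(exp P) R_(exp Q) = exp L_P exp R_Q = exp D]
    ([expB_bop_mull], [expB_bop_mulr], [expBD]), and [exp D - 1] is [D] times a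
    power series in [D], so that [D^n X = 0] forces [(exp D - 1)^n X = 0]
    ([expB_sub1X_nilpotent]).

    The operators [L_P], [R_Q] and [D] are bounded operators on the Banach space
    of bounded operators, so the exponentials of [P] and of [L_P] are instances
    of the same function [expB].  Analysis enters twice.  The addition formula
    for commuting operators is the Cauchy product of two series, whose error
    term is dominated by that of the real exponential series.  The compatibility
    of [expB] with [L], [R] and the adjoint is the continuity of these maps, all
    of which are norm-decreasing ([contraction_expB]). *)

(** * Truncated Cauchy products *)

Lemma sum_triangle (V : nmodType) (c : nat -> nat -> V) N :
  \sum_(0 <= k < N) \sum_(0 <= i < k.+1) c i (k - i)%N =
  \sum_(0 <= i < N) \sum_(0 <= j < N - i) c i j.
Proof.
elim: N => [|N IHN]; first by rewrite !big_geq.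
rewrite big_nat_recr//= {}IHN [RHS]big_nat_recr//= subSnn big_nat1.
rewrite [X in _ + X]big_nat_recr//= subnn addrA; congr (_ + _).
rewrite -big_split/=; apply: eq_big_nat => i /andP[_ iN].
by rewrite subSn ?(ltnW iN)// big_nat_recr.
Qed.

(** The error of a truncated Cauchy product is the sum over the upper triangle
    of the square; as it involves no subtraction, bounds on the terms of [c]
    carry over to it. *)
Lemma sum_square_sub_triangle (V : zmodType) (c : nat -> nat -> V) N :
  \sum_(0 <= i < N) \sum_(0 <= j < N) c i j -
  \sum_(0 <= k < N) \sum_(0 <= i < k.+1) c i (k - i)%N =
  \sum_(0 <= i < N) \sum_(N - i <= j < N) c i j.
Proof.
rewrite sum_triangle -sumrB; apply: eq_big_nat => i /andP[_ iN].
by rewrite [X in X - _](@big_cat_nat _ _ _ (N - i)%N)//= ?leq_subr//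
  addrAC subrr add0r.
Qed.

Lemma exp_coeff_conv (R : realType) (a b : R) k :
  exp_coeff (a + b) k =
  \sum_(0 <= i < k.+1) exp_coeff a i * exp_coeff b (k - i)%N.
Proof.
rewrite /exp_coeff/= addrC exprDn mulr_suml big_mkord.
apply: eq_bigr => -[i /= ik] _.
have fn0 j : j`!%:R != 0 :> R by rewrite pnatr_eq0 -lt0n fact_gt0.
have bn0 : 'C(k, i)%:R != 0 :> R by rewrite pnatr_eq0 -lt0n bin_gt0.
rewrite -(bin_fact (ltnSE ik)) !natrM -mulr_natr; field.
by rewrite bn0 !fn0.
Qed.

(** * The algebra of bounded operators *)

Lemma norm_le_cvg0 (K : numFieldType) (V : normedModType K)
    (w : nat -> V) (f : nat -> K) :
  (forall k, `|w k| <= f k) -> (f @ \oo --> 0)%classic ->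
  (w @ \oo --> 0)%classic.
Proof.
move=> wf /cvgr0Pnorm_lt f0; apply/cvgr0Pnorm_lt => e e0.
apply: filterS (f0 e e0) => k; apply: le_lt_trans.
apply: le_trans (wf k) (real_ler_norm (ger0_real _)).
exact: le_trans (wf k).
Qed.

Lemma norm_le_real_cvg0 (R : realType) (V : normedModType R[i])
    (w : nat -> V) (f : nat -> R) :
  (forall k, `|w k| <= (f k)%:C) -> (f @ \oo --> 0)%classic ->
  (w @ \oo --> 0)%classic.
Proof.
move=> wf /cvgr0Pnorm_lt f0; apply/cvgr0Pnorm_lt => e e0.
have eE : (complex.Re e)%:C = e by rewrite (RRe_real (gtr0_real e0)).
have Re0 : 0 < complex.Re e by rewrite -ltcR eE.
apply: filterS (f0 _ Re0) => k; rewrite -ltcR eE => fk.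
rewrite (le_lt_trans (wf k))// (le_lt_trans _ fk)// lecR.
exact: ler_norm.
Qed.

Section OperatorAlgebra.
Context {R : realType} {H : normedModType R[i]}.
Implicit Types A B C : bop H.

Lemma bopME A B x : (A * B) x = A (B x).
Proof. by []. Qed.

Lemma bop1E x : (1 : bop H) x = x.
Proof. by []. Qed.

Lemma bopZE (a : R[i]) A x : (a *: A) x = a *: A x.
Proof. by []. Qed.

Lemma bop_sumE (I : Type) (r : seq I) (F : I -> bop H) x :
  (\sum_(i <- r) F i) x = \sum_(i <- r) F i x.
Proof. by elim/big_rec2: _ => // i _ B _ <-. Qed.

Lemma bop_scalerAl (a : R[i]) A B : a *: (A * B) = (a *: A) * B.
Proof. by apply/bopP. Qed.

Lemma bop_scalerAr (a : R[i]) A B : a *: (A * B) = A * (a *: B).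
Proof. by apply/bopP => x; rewrite /= [RHS]linearZ. Qed.

Lemma bop_scaleX (a : R[i]) A k : (a *: A) ^+ k = a ^+ k *: A ^+ k.
Proof.
elim: k => [|k IHk]; first by rewrite !expr0 scale1r.
by rewrite !exprS IHk -bop_scalerAl -bop_scalerAr scalerA.
Qed.

Lemma bop_scale_sandwich (a b : R[i]) A B C k l :
  (a *: A) ^+ k * B * (b *: C) ^+ l = (a ^+ k * b ^+ l) *: (A ^+ k * B * C ^+ l).
Proof. by rewrite !bop_scaleX -!bop_scalerAl -bop_scalerAr scalerA. Qed.

Lemma bop_normrM A B : `|A * B| <= `|A| * `|B|.
Proof. exact: opnormM. Qed.

Lemma bop_cvgM (u v : nat -> bop H) A B :
  (u @ \oo --> A)%classic -> (v @ \oo --> B)%classic ->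
  ((fun k => u k * v k) @ \oo --> A * B)%classic.
Proof.
move=> /subr_cvg0/norm_cvg0P uA /subr_cvg0/norm_cvg0P vB; apply/subr_cvg0.
have le_uv k : `|u k * v k - A * B| <= `|u k - A| * `|v k - B| +
    (`|A| * `|v k - B| + `|u k - A| * `|B|).
  have -> : u k * v k - A * B =
      (u k - A) * (v k - B) + (A * (v k - B) + (u k - A) * B).
    by rewrite addrA -mulrDl subrK mulrBr mulrBl addrA subrK.
  rewrite (le_trans (ler_normD _ _))// lerD ?bop_normrM//.
  by rewrite (le_trans (ler_normD _ _))// lerD ?bop_normrM.
apply: (norm_le_cvg0 le_uv).
have := cvgD (cvgM uA vB)
  (cvgD (cvgM (cvg_cst `|A|) vB) (cvgM uA (cvg_cst `|B|))).
by rewrite !(mulr0, mul0r, addr0) => h; exact: h.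
Qed.

End OperatorAlgebra.

(** * The exponential of a sum of commuting operators *)

Section ExponentialSeries.
Context {R : realType} {H : normedModType R[i]}.
Implicit Types A B : bop H.

Definition expB_coeff A k : bop H := k`!%:R^-1 *: A ^+ k.

Lemma expB_coeff_conv A B k : GRing.comm A B ->
  expB_coeff (A + B) k =
  \sum_(0 <= i < k.+1) expB_coeff A i * expB_coeff B (k - i)%N.
Proof.
move=> cAB; rewrite /expB_coeff addrC (exprDn_comm _ (commr_sym cAB)).
rewrite scaler_sumr big_mkord; apply: eq_bigr => -[i /= ik] _.
rewrite -bop_scalerAl -bop_scalerAr scalerA.
rewrite (commrX _ (commr_sym (commrX _ cAB))) -[_ *+ 'C(k, i)]scaler_nat scalerA.
congr (_ *: _).
have fn0 j : j`!%:R != 0 :> R[i] by rewrite pnatr_eq0 -lt0n fact_gt0.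
have bn0 : 'C(k, i)%:R != 0 :> R[i] by rewrite pnatr_eq0 -lt0n bin_gt0.
by rewrite -(bin_fact (ltnSE ik)) !natrM; field; rewrite bn0 !fn0.
Qed.

Lemma norm_expB_coeff A k :
  `|expB_coeff A k| <= (exp_coeff (complex.Re `|A|) k)%:C.
Proof.
have aE : (complex.Re `|A|)%:C = `|A| by rewrite RRe_real ?ger0_real.
rewrite /exp_coeff/= rmorphM/= rmorphXn/= aE fmorphV rmorph_nat mulrC.
rewrite normrZ normfV normr_nat.
by rewrite ler_wpM2l ?invr_ge0 ?ler0n//; exact: opnormX.
Qed.

(** Both sides are sums over the same upper triangle of indices, and each term
    on the left is bounded in norm by the corresponding term on the right. *)
Lemma norm_series_expB_conv A B N : GRing.comm A B ->
  `|series (expB_coeff A) N * series (expB_coeff B) N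
    - series (expB_coeff (A + B)) N| <=
  (series (exp_coeff (complex.Re `|A|)) N *
   series (exp_coeff (complex.Re `|B|)) N -
   series (exp_coeff (complex.Re `|A| + complex.Re `|B|)) N)%:C.
Proof.
move=> cAB; have cA := norm_expB_coeff A; have cB := norm_expB_coeff B.
set a := complex.Re `|A| in cA *; set b := complex.Re `|B| in cB *.
rewrite /series; under [X in _ - X]eq_bigr do rewrite expB_coeff_conv//.
under [X in (_ - X)%:C]eq_bigr do rewrite exp_coeff_conv.
rewrite !big_distrlr.
rewrite (sum_square_sub_triangle (fun i j => expB_coeff A i * expB_coeff B j)).
rewrite (sum_square_sub_triangle (fun i j => exp_coeff _ i * exp_coeff _ j)).
rewrite rmorph_sum (le_trans (ler_norm_sum _ _ _))// ler_sum// => i _.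
rewrite rmorph_sum (le_trans (ler_norm_sum _ _ _))// ler_sum// => j _.
by rewrite (le_trans (bop_normrM _ _))// [leRHS]rmorphM ler_pM.
Qed.
End ExponentialSeries.

Lemma cvg_expB (R : realType) (H : completeNormedModType R[i]) (A : bop H) :
  (series (expB_coeff A) @ \oo --> expB A)%classic.
Proof. exact: is_cvg_series_expB. Qed.
Arguments cvg_expB {R H} A.

Section Exponential.
Context {R : realType}.

(** The error of the truncated Cauchy product tends to 0 because it is bounded
    by that of the real exponentials of the norms, for which the addition
    formula is known. *)
Lemma expBD (H : completeNormedModType R[i]) (A B : bop H) :
  GRing.comm A B -> expB (A + B) = expB A * expB B.
Proof.
move=> cAB; apply/eqP; rewrite eq_sym -subr_eq0; apply/eqP.
pose a := complex.Re `|A|; pose b := complex.Re `|B|.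
have cl : ((fun N => series (expB_coeff A) N * series (expB_coeff B) N
    - series (expB_coeff (A + B)) N) @ \oo -->
    expB A * expB B - expB (A + B))%classic.
  by apply: cvgB (cvg_expB _); apply: bop_cvgM; exact: cvg_expB.
refine (norm_cvg_unique cl _).
apply: (norm_le_real_cvg0 (fun N => norm_series_expB_conv N cAB)).
have ca x : (series (@exp_coeff R x) @ \oo --> expR x)%classic.
  exact: is_cvg_series_exp_coeff.
rewrite -(subrr (expR (a + b))) [X in (_ --> X - _)%classic]expRD.
exact: cvgB (cvgM (ca a) (ca b)) (ca (a + b)).
Qed.

(** Only additivity is asked of [phi], because this is to be applied to the
    conjugate-linear adjoint as well as to the linear multiplication maps. *)
Lemma contraction_expB (E F : completeNormedModType R[i])
    (phi : bop E -> bop F) (A : bop E) (B : bop F) :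
  {morph phi : X Y / X - Y} -> (forall X, `|phi X| <= `|X|) ->
  (forall k, phi (expB_coeff A k) = expB_coeff B k) ->
  phi (expB A) = expB B.
Proof.
move=> phiB phi_le phiAB.
have phi0 : phi 0 = 0 by rewrite -(subrr 0) phiB subrr.
have phiN X : phi (- X) = - phi X by rewrite -sub0r phiB phi0 sub0r.
have phiD X Y : phi (X + Y) = phi X + phi Y.
  by rewrite -[Y in LHS]opprK phiB phiN opprK.
apply/eqP; rewrite -subr_eq0; apply/eqP.
(* The images by phi of the partial sums of exp A are those of exp B, so that
   the latter converge to phi (exp A) as well as to exp B. *)
have cl : (series (expB_coeff B) - series (expB_coeff B) @ \oo -->
   phi (expB A) - expB B)%classic.
  apply: cvgB; last exact: cvg_expB.
  apply/subr_cvg0; have /subr_cvg0/norm_cvg0P := cvg_expB A.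
  apply: norm_le_cvg0 => N; apply: le_trans (phi_le _).
  rewrite phiB /series/= (big_morph _ phiD phi0).
  by under [X in _ <= `|X - _|]eq_bigr do rewrite phiAB.
refine (norm_cvg_unique cl _).
by rewrite subrr; exact: cvg_cst.
Qed.
End Exponential.

(** * Left and right multiplications *)

Section Multiplication.
Context {R : realType} {H : normedModType R[i]}.
Implicit Types A B X : bop H.

Lemma mull_bounded A : ( *%R A) \in @bounded_linear R (bop H).
Proof.
apply/bounded_linearP; split=> [a X Y|]; last first.
  by exists `|A| => X; exact: bop_normrM.
by rewrite mulrDr bop_scalerAr.
Qed.

Lemma mulr_bounded A : (fun X => X * A) \in @bounded_linear R (bop H).
Proof.
apply/bounded_linearP; split=> [a X Y|].
  by rewrite mulrDl bop_scalerAl.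
by exists `|A| => X; rewrite mulrC; exact: bop_normrM.
Qed.

Definition bop_mull A : bop (bop H) := BOp (mull_bounded A).
Definition bop_mulr A : bop (bop H) := BOp (mulr_bounded A).

Lemma bop_mull_mulr A B : GRing.comm (bop_mull A) (bop_mulr B).
Proof. by apply/bopP => X; exact: mulrA. Qed.

Lemma bop_mullX A k : bop_mull A ^+ k = bop_mull (A ^+ k).
Proof.
elim: k => [|k IHk]; first by apply/bopP => X; rewrite /= mul1r.
by rewrite !exprS IHk; apply/bopP => X; exact: mulrA.
Qed.

Lemma bop_mulrX A k : bop_mulr A ^+ k = bop_mulr (A ^+ k).
Proof.
elim: k => [|k IHk]; first by apply/bopP => X; rewrite /= mulr1.
by rewrite !exprS IHk -exprS exprSr; apply/bopP => X; rewrite /= mulrA.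
Qed.

Lemma norm_bop_mull A : `|bop_mull A| <= `|A|.
Proof.
apply: opnorm_le => X X1; rewrite (le_trans (bop_normrM A X))//.
by rewrite ler_piMr.
Qed.

Lemma norm_bop_mulr A : `|bop_mulr A| <= `|A|.
Proof.
apply: opnorm_le => X X1; rewrite (le_trans (bop_normrM X A))//.
by rewrite ler_piMl.
Qed.
End Multiplication.

Section ExponentialMultiplication.
Context {R : realType} {H : completeNormedModType R[i]}.

Lemma expB_bop_mull (A : bop H) : expB (bop_mull A) = bop_mull (expB A).
Proof.
symmetry; apply: contraction_expB => [X Y||k].
- by apply/bopP => Z; exact: mulrBl.
- exact: norm_bop_mull.
- by rewrite /expB_coeff bop_mullX; apply/bopP => Z; exact/esym/bop_scalerAl.
Qed.

Lemma expB_bop_mulr (A : bop H) : expB (bop_mulr A) = bop_mulr (expB A).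
Proof.
symmetry; apply: contraction_expB => [X Y||k].
- by apply/bopP => Z; exact: mulrBr.
- exact: norm_bop_mulr.
- by rewrite /expB_coeff bop_mulrX; apply/bopP => Z; exact/esym/bop_scalerAr.
Qed.

End ExponentialMultiplication.

(** * Exponentials of locally nilpotent operators *)

Section LocallyNilpotent.
Context {R : realType} {H : completeNormedModType R[i]}.

Lemma expB_nilpotent_at (D : bop H) n (x : H) :
  (D ^+ n) x = 0 -> expB D x = \sum_(0 <= k < n) k`!%:R^-1 *: (D ^+ k) x.
Proof.
move=> Dn0; pose s N := \sum_(0 <= k < N) k`!%:R^-1 *: (D ^+ k) x.
have sE N : series (expB_coeff D) N x = s N.
  by rewrite /series/= /s bop_sumE.
have cs : (s @ \oo --> expB D x)%classic.
  apply/subr_cvg0; have /subr_cvg0/norm_cvg0P eD := cvg_expB D.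
  apply: (@norm_le_cvg0 _ _ _
    (fun N => `|series (expB_coeff D) N - expB D| * `|x|)).
    by move=> N; rewrite -sE; exact: opnormP.
  have := cvgM eD (cvg_cst `|x|); rewrite mul0r => h; exact: h.
refine (norm_cvg_unique cs _).
apply: (@cvg_near_cst _ _ (s n)); exists n => // N /= nN.
rewrite /s (@big_cat_nat _ _ _ n)//=.
rewrite [X in _ + X]big_nat_cond [X in _ + X]big1 ?addr0//.
move=> k /andP[/andP[nk _] _]; rewrite -(subnK nk) exprD.
by rewrite bopME Dn0 linear0 scaler0.
Qed.

(** The series [(exp D - 1) x] has no term of order 0 in [D], so [exp D - 1]
    maps the kernel of [D^(n+1)] into that of [D^n]. *)
Lemma expB_sub1X_nilpotent (D : bop H) n (x : H) :
  (D ^+ n) x = 0 -> ((expB D - 1) ^+ n) x = 0.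
Proof.
elim: n x => [//|n IHn] x Dx; rewrite exprSr; apply: IHn.
rewrite [(expB D - 1) x](_ : _ = expB D x - x)// (expB_nilpotent_at Dx).
rewrite big_nat_recl// fact0 invr1 scale1r expr0 bop1E addrAC subrr add0r.
have Dk0 k : (D ^+ n) ((D ^+ k.+1) x) = 0.
  by rewrite -bopME -exprD addnS -addSn addnC exprD bopME Dx linear0.
rewrite linear_sum big1// => k _; apply: etrans (linearZ _ _) _.
by rewrite /= Dk0 scaler0.
Qed.
End LocallyNilpotent.

(** * Adjoints of exponentials *)

Section Adjoint.
Context {R : realType} {H : hilbertType R}.
Implicit Types (A B : bop H) (x y z : H).

Lemma inner_inj y z : (forall x, inner x y = inner x z) -> y = z.
Proof.
move=> yz; apply/eqP; rewrite -subr_eq0 -normr_eq0 -sqrf_eq0 normr_inner.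
by rewrite linearBr/= yz subrr.
Qed.

(** The Cauchy-Schwarz inequality for a nonnegative inner product [u], by
    expanding the squared norm of [b *: x - u *: y] with [b = inner y y]. *)
Lemma inner_le x y : 0 <= inner x y -> inner x y <= `|x| * `|y|.
Proof.
move=> u0; have [y0|y0] := eqVneq y 0.
  by rewrite y0 linear0r normr0 mulr0.
have b0 : 0 < inner y y by rewrite -normr_inner exprn_gt0 ?normr_gt0.
have xy : inner y x = inner x y.
  by rewrite hermC /= expr0 mul1r; exact: (CrealP (ger0_real u0)).
rewrite -ler_sqr ?nnegrE ?mulr_ge0// exprMn !normr_inner.
set u := inner x y in u0 xy *; set a := inner x x; set b := inner y y in b0 *.
have bJ : conjc b = b by exact: (CrealP (gtr0_real b0)).
have uJ : conjc u = u by exact: (CrealP (ger0_real u0)).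
have : 0 <= inner (b *: x - u *: y) (b *: x - u *: y).
  by rewrite -normr_inner exprn_ge0.
rewrite !(linearBl, linearBr, linearZl_LR, linearZr_LR)/= xy -/u -/a -/b bJ uJ.
have scaleE (c d : R[i]) : c *: (d : R[i]^o) = c * d by [].
rewrite !scaleE [leRHS](_ : _ = b * (a * b - u ^+ 2)); last by ring.
by rewrite pmulr_rge0// subr_ge0.
Qed.

Lemma adj_eq A B : (forall x y, inner (A x) y = inner x (B y)) -> adj A = B.
Proof.
by move=> AB; apply/bopP => y; apply: inner_inj => x; rewrite -adjP AB.
Qed.

Lemma adjB : {morph @adj R H : A B / A - B}.
Proof.
move=> A B; apply: adj_eq => x y.
by rewrite [LHS]linearBl [RHS]linearBr /= !adjP.
Qed.

Lemma adjZ (a : R[i]) A : adj (a *: A) = conjc a *: adj A.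
Proof.
apply: adj_eq => x y.
by rewrite [LHS]linearZl_LR [RHS]linearZr_LR/= conjcK adjP.
Qed.

Lemma adjX A k : adj (A ^+ k) = adj A ^+ k.
Proof.
elim: k => [|k IHk]; first exact: adj_eq.
by apply: adj_eq => x y; rewrite exprS exprSr /= !adjP IHk.
Qed.

(** [|B y|^2 = <A (B y), y> <= |A| |B y| |y|] for [B = adj A]. *)
Lemma norm_adj A : `|adj A| <= `|A|.
Proof.
apply: opnorm_le => y y1; have [->|By0] := eqVneq (adj A y) 0.
  by rewrite normr0 normr_ge0.
rewrite -(@ler_pM2r _ `|adj A y|) ?normr_gt0// -expr2 normr_inner.
have uE := adjP A (adj A y) y.
rewrite -uE (le_trans (inner_le _))//.
  by rewrite uE -normr_inner exprn_ge0.
rewrite -[leRHS]mulr1 ler_pM//; exact: opnormP.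
Qed.

Lemma adj_expB A : adj (expB A) = expB (adj A).
Proof.
apply: contraction_expB; [exact: adjB|exact: norm_adj|move=> k].
by rewrite /expB_coeff adjZ adjX fmorphV rmorph_nat.
Qed.
End Adjoint.

(** * Vanishing of the binomial sums of exponentials *)

(** With [D = L_P + R_Q], the hypothesis says that [D^n X = 0] and the
    conclusion that [(exp D - 1)^n X = 0]. *)
Lemma sandwich_expB (R : realType) (H : completeNormedModType R[i])
    (P Q X : bop H) n :
  \sum_(k < n.+1) 'C(n, k)%:R *: (P ^+ k * X * Q ^+ (n - k)) = 0 ->
  \sum_(k < n.+1) ((-1) ^+ (n - k) * 'C(n, k)%:R) *:
    (expB P ^+ k * X * expB Q ^+ k) = 0.
Proof.
have cPQ := bop_mull_mulr.
pose D := bop_mulr Q + bop_mull P => PQ0.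
have DX : (D ^+ n) X = 0.
  rewrite -[RHS]PQ0 (exprDn_comm _ (commr_sym (cPQ _ _ _ _))) bop_sumE.
  apply: eq_bigr => k _.
  by rewrite -[_ *+ 'C(n, k)]scaler_nat bop_mullX bop_mulrX bopZE bopME.
have := expB_sub1X_nilpotent DX.
rewrite (expBD (commr_sym (cPQ _ _ _ _))) expB_bop_mull expB_bop_mulr addrC.
rewrite (exprDn_comm _ (commr_sym (commrN1 _))) => E0; rewrite -[RHS]E0 bop_sumE.
apply: eq_bigr => k _; apply/esym; rewrite -[_ *+ 'C(n, k)]scaler_nat bopZE.
rewrite bopME (exprMn_comm _ (commr_sym (cPQ _ _ _ _))) bop_mullX bop_mulrX.
by rewrite -scaleN1r bop_scaleX expr1n bopZE scalerA mulrC.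
Qed.

Unset Implicit Arguments.

Theorem theorem2p10 (R : realType) (H : hilbertType R) (Hsep : separable H)
    (A T : bop H) (Apos : positive A) (m n : nat) :
  (isosymmetric m n A T ->
     forall s : R,
       \sum_(k < n.+1) ((-1) ^+ (n - k) * 'C(n, k)%:R) *:
         (adj (expB ((0 +i* s) *: T)) ^+ k * Iop m A T *
          expB ((0 +i* s) *: T) ^+ k) = 0) /\
  (skew_isosymmetric m n A T ->
     forall s : R,
       \sum_(k < n.+1) ((-1) ^+ (n - k) * 'C(n, k)%:R) *:
         (expB ((0 +i* s) *: adj T) ^+ k * Iop m A T *
          expB ((0 +i* s) *: T) ^+ k) = 0).
Proof.
split=> X0 s; set c := 0 +i* s.
- rewrite adj_expB adjZ; apply: sandwich_expB.
  have -> : conjc c = - c by rewrite /c; simpc.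
  (* (- c)^k c^(n-k) = (-1)^n c^n (-1)^(n-k): the sum is a multiple of Omega. *)
  rewrite -[RHS](scaler0 _ ((-1) ^+ n * c ^+ n))
    -[X in _ = _ *: X]X0 scaler_sumr.
  apply: eq_bigr => -[k /= kn] _; rewrite bop_scale_sandwich !scalerA.
  have sk : (-1) ^+ k = (-1) ^+ n * (-1) ^+ (n - k) :> R[i].
    by rewrite -{1}(subnKC (ltnSE kn)) exprD -mulrA -expr2 sqrr_sign mulr1.
  have cn : c ^+ n = c ^+ k * c ^+ (n - k) by rewrite -exprD subnKC.
  by congr (_ *: _); rewrite [(- c) ^+ k]exprNn sk cn; ring.
- apply: sandwich_expB.
  rewrite -[RHS](scaler0 _ (c ^+ n)) -[X in _ = _ *: X]X0 scaler_sumr.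
  apply: eq_bigr => -[k /= kn] _; rewrite bop_scale_sandwich !scalerA.
  by rewrite -exprD subnKC// mulrC.
Qed.
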